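(* Let $\mathcal{G}\rightrightarrows M$ be a Lie groupoid. The reduced space $R^0_{\mathrm{mult}}$ of multiplicative $0$-vectors on $\mathcal{G}$ is isomorphic to $\mathrm{H}^1(\mathcal{G},\mathbb{R})$, the degree $1$ cohomology of $\mathcal{G}$ with respect to the trivial action of $\mathcal{G}$ on $M\times\mathbb{R}$.
   Context: $\mathcal{G}$ has source $s$ and target $t$; $gr$ is defined when $s(g)=t(r)$. A multiplicative $0$-vector on $\mathcal{G}$ is a function $F\in C^\infty(\mathcal{G})$ with $F(gr)=F(g)+F(r)$ for all composable $(g,r)$. It is exact if $F=t^*f-s^*f$ for some $f\in C^\infty(M)$. $R^0_{\mathrm{mult}}$ is the space of multiplicative $0$-vectors modulo exact ones. For a $\mathcal{G}$-module $E$ with action $\Phi_g:E_{s(g)}\to E_{t(g)}$, $\mathrm{H}^1(\mathcal{G},E)$ is the space of smooth $1$-cocycles $c(g)\in E_{t(g)}$, $c(gr)=c(g)+\Phi_gc(r)$, modulo coboundaries $(d_{\mathcal{G}}\nu)(g)=\Phi_g\nu_{s(g)}-\nu_{t(g)}$, $\nu\in\Gamma(E)$. *)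

(* Defs.v *)
From HB Require Import structures.
From mathcomp Require Import all_boot all_order all_algebra.
From mathcomp Require Import all_classical all_reals all_analysis.
Import Order.TTheory GRing.Theory Num.Theory.
Import numFieldNormedType.Exports.

Set Implicit Arguments.
Unset Strict Implicit.
Unset Printing Implicit Defensive.

Local Open Scope classical_set_scope.
Local Open Scope ring_scope.

Record submodule (R : pzRingType) (V : lmodType R) := Submodule {
  submod_set : set V;
  submod0 : submod_set 0;
  submodP : forall (a : R) (u v : V),
    submod_set u -> submod_set v -> submod_set (a *: u + v) }.

Section Submodule.
Context (R : pzRingType) (V : lmodType R) (S : submodule V).

Definition submod_pred : {pred V} := fun v => `[< submod_set S v >].

Lemma submod_predP : submod_closed submod_pred.
Proof.
split; first by apply/asboolP; exact: submod0.
by move=> a u v /asboolP Su /asboolP Sv; apply/asboolP; exact: submodP.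
Qed.

HB.instance Definition _ :=
  GRing.isSubmodClosed.Build R V submod_pred submod_predP.

Record subspace := Subspace { subspace_val :> V; _ : subspace_val \in submod_pred }.

HB.instance Definition _ := [isSub for subspace_val].
HB.instance Definition _ := [Choice of subspace by <:].
HB.instance Definition _ := [SubChoice_isSubLmodule of subspace by <:].

Definition lmod_quot := @Quotient.quot V submod_pred.

HB.instance Definition _ := ZmodQuotient.on lmod_quot.

Local Open Scope quotient_scope.

Definition lmod_quot_scale (a : R) (x : lmod_quot) : lmod_quot :=
  \pi_lmod_quot (a *: repr x).

Lemma pi_scale (a : R) (v : V) :
  lmod_quot_scale a (\pi_lmod_quot v) = \pi_lmod_quot (a *: v).
Proof.
rewrite /lmod_quot_scale; apply/eqP.
rewrite -Quotient.idealrBE -scalerBr rpredZ // Quotient.idealrBE.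
by rewrite reprK.
Qed.

Lemma lmod_quot_scaleA a b x :
  lmod_quot_scale a (lmod_quot_scale b x) = lmod_quot_scale (a * b) x.
Proof. by elim/quotW: x => u; rewrite (pi_scale b u) !pi_scale scalerA. Qed.

Lemma lmod_quot_scale1 : left_id 1 lmod_quot_scale.
Proof. by elim/quotW=> u; rewrite pi_scale scale1r. Qed.

Lemma lmod_quot_scaleDr : right_distributive lmod_quot_scale +%R.
Proof.
move=> a; elim/quotW=> u; elim/quotW=> v.
by rewrite -raddfD !pi_scale -raddfD scalerDr.
Qed.

Lemma lmod_quot_scaleDl x : {morph lmod_quot_scale^~ x : a b / a + b}.
Proof.
by move=> a b; elim/quotW: x => u; rewrite !pi_scale -raddfD scalerDl.
Qed.

HB.instance Definition _ := GRing.Zmodule_isLmodule.Build R lmod_quot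
  lmod_quot_scaleA lmod_quot_scale1 lmod_quot_scaleDr lmod_quot_scaleDl.

End Submodule.

Definition dfun (R : pzRingType) (T : Type) (E : T -> lmodType R) : Type :=
  forall x, E x.

Section Dfun.
Context (R : pzRingType) (T : Type) (E : T -> lmodType R).
Implicit Types f g h : dfun E.

HB.instance Definition _ := gen_eqMixin (dfun E).
HB.instance Definition _ := gen_choiceMixin (dfun E).

Definition dfun0 : dfun E := fun=> 0.
Definition dfun_opp f : dfun E := fun x => - f x.
Definition dfun_add f g : dfun E := fun x => f x + g x.
Definition dfun_scale (a : R) f : dfun E := fun x => a *: f x.

Lemma dfun_addA : associative dfun_add.
Proof. by move=> f g h; apply: functional_extensionality_dep => x; exact: addrA. Qed.
Lemma dfun_addC : commutative dfun_add.
Proof. by move=> f g; apply: functional_extensionality_dep => x; exact: addrC. Qed.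
Lemma dfun_add0 : left_id dfun0 dfun_add.
Proof. by move=> f; apply: functional_extensionality_dep => x; exact: add0r. Qed.
Lemma dfun_addN : left_inverse dfun0 dfun_opp dfun_add.
Proof. by move=> f; apply: functional_extensionality_dep => x; exact: addNr. Qed.

HB.instance Definition _ := GRing.isZmodule.Build (dfun E)
  dfun_addA dfun_addC dfun_add0 dfun_addN.

Lemma dfun_scaleA a b f : dfun_scale a (dfun_scale b f) = dfun_scale (a * b) f.
Proof. by apply: functional_extensionality_dep => x; exact: scalerA. Qed.
Lemma dfun_scale1 : left_id 1 dfun_scale.
Proof. by move=> f; apply: functional_extensionality_dep => x; exact: scale1r. Qed.
Lemma dfun_scaleDr : right_distributive dfun_scale +%R.
Proof. by move=> a f g; apply: functional_extensionality_dep => x; exact: scalerDr. Qed.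
Lemma dfun_scaleDl f : {morph dfun_scale^~ f : a b / a + b}.
Proof. by move=> a b; apply: functional_extensionality_dep => x; exact: scalerDl. Qed.

HB.instance Definition _ := GRing.Zmodule_isLmodule.Build R (dfun E)
  dfun_scaleA dfun_scale1 dfun_scaleDr dfun_scaleDl.

Lemma dfun_linE a f g x : (a *: f + g) x = a *: f x + g x.
Proof. by []. Qed.

End Dfun.

Definition fcast (R : pzRingType) (T : Type) (E : T -> lmodType R) (x y : T)
  (xy : x = y) (e : E x) : E y := ecast z (E z) xy e.

(** The iterated directional derivatives of order up to [k] exist on the open set
    [U], and those of order [k] are continuous there.  For finite-dimensional
    [V], requiring this for every [k], as [Cinf] does, is the usual notion of a
    C^oo map. *)
Fixpoint Ck (R : realType) (V W : normedModType R) (k : nat) (U : set V)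
    (f : V -> W) : Prop :=
  if k is k'.+1 then
    forall v : V, (forall x, U x -> derivable f x v) /\ Ck k' U ('D_v f)
  else forall x, U x -> {for x, continuous f}.

Definition Cinf (R : realType) (V W : normedModType R) (U : set V)
  (f : V -> W) : Prop := forall k, Ck k U f.

Section CkTheory.
Context (R : realType) (V W : normedModType R).
Implicit Types (U : set V) (f g : V -> W).

Lemma eq_Ck k U f g : open U -> (forall x, U x -> f x = g x) ->
  Ck k U f -> Ck k U g.
Proof.
move=> oU; elim: k f g => [|k IHk] f g fg /= Cf.
  move=> x Ux; have nfg : \forall y \near x, f y = g y.
    by apply: filterS (open_nbhs_nbhs (conj oU Ux)) => y; exact: fg.
  have := Cf x Ux; rewrite /prop_for /continuous_at -(fg _ Ux) => fx.
  exact: cvg_trans (near_eq_cvg nfg) fx.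
have nfg x : U x -> \forall y \near x, f y = g y.
  by move=> Ux; apply: filterS (open_nbhs_nbhs (conj oU Ux)) => y; exact: fg.
move=> v; have [df Cdf] := Cf v; split.
  by move=> x Ux; apply: near_eq_derivable (df x Ux); exact: nfg.
by apply: IHk Cdf => x Ux; apply: near_eq_derive; exact: nfg.
Qed.

Lemma Ck_cst k U (w : W) : open U -> Ck k U (fun=> w).
Proof.
move=> oU; elim: k w => [|k IHk] w /=; first by move=> x _; exact: cvg_cst.
move=> v; split=> [x _|]; first exact: derivable_cst.
by apply: eq_Ck (IHk 0) => // x _; rewrite derive_cst.
Qed.

Lemma Ck_lin k U f g (a : R) : open U -> Ck k U f -> Ck k U g ->
  Ck k U (fun x => a *: f x + g x).
Proof.
move=> oU; elim: k f g => [|k IHk] f g /= Cf Cg.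
  move=> x Ux; apply: cvgD (Cg x Ux).
  by apply: cvgZl_tmp; exact: Cf.
move=> v; have [df Cdf] := Cf v; have [dg Cdg] := Cg v; split.
  move=> x Ux; apply: derivableD; last exact: dg.
  by apply: derivableZ; exact: df.
apply: eq_Ck (IHk _ _ Cdf Cdg) => // x Ux.
have daf : derivable (a \*: f) x v by apply: derivableZ; exact: df.
by rewrite -[RHS]/('D_v ((a \*: f) + g) x) deriveD ?deriveZ //; [exact: df|exact: dg].
Qed.

End CkTheory.

(** [chart_map i] is meaningful only on [chart_dom i], and [chart_inv i] only on
    the image of [chart_dom i]. *)
Record charts (R : realType) (V : normedModType R) (T : topologicalType) :=
  Charts {
    chart_idx : Type;
    chart_dom : chart_idx -> set T;
    chart_map : chart_idx -> T -> V;
    chart_inv : chart_idx -> V -> T }.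

Definition chart_image (R : realType) (V : normedModType R)
    (T : topologicalType) (A : charts V T) (i : chart_idx A) : set V :=
  chart_map i @` chart_dom i.

Record smooth_atlas (R : realType) (V : normedModType R)
    (T : topologicalType) (A : charts V T) : Prop := SmoothAtlas {
  chart_cover : forall x, exists i : chart_idx A, chart_dom i x;
  chart_dom_open : forall i : chart_idx A, open (chart_dom i);
  chart_image_open : forall i : chart_idx A, open (chart_image i);
  chart_mapK : forall (i : chart_idx A) x,
    chart_dom i x -> chart_inv i (chart_map i x) = x;
  chart_map_cont : forall (i : chart_idx A) x,
    chart_dom i x -> {for x, continuous (chart_map i)};
  chart_inv_cont : forall (i : chart_idx A) y,
    chart_image i y -> {for y, continuous (chart_inv i)};
  chart_transition : forall i j : chart_idx A,
    Cinf (chart_map i @` (chart_dom i `&` chart_dom j))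
         (chart_map j \o chart_inv i) }.

Record manifold (R : realType) (n : nat) := Manifold {
  manifold_space :> topologicalType;
  atlas : charts 'rV[R]_n manifold_space;
  atlasP : smooth_atlas atlas;
  manifold_hausdorff : hausdorff_space manifold_space;
  manifold_second_countable : @second_countable manifold_space }.

Definition prod_charts (R : realType) (V W : normedModType R)
    (S T : topologicalType) (A : charts V S) (B : charts W T) :
    charts (V * W)%type (S * T)%type :=
  @Charts R (V * W)%type (S * T)%type (chart_idx A * chart_idx B)%type
    (fun ij => chart_dom ij.1 `*` chart_dom ij.2)
    (fun ij p => (chart_map ij.1 p.1, chart_map ij.2 p.2))
    (fun ij q => (chart_inv ij.1 q.1, chart_inv ij.2 q.2)).

(** [U] is meant to be open, here and in [smooth_map_on]. *)
Definition smooth_fun_on (R : realType) (V W : normedModType R)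
    (S : topologicalType) (A : charts V S) (U : set S) (f : S -> W) : Prop :=
  forall i : chart_idx A,
    Cinf (chart_map i @` (chart_dom i `&` U)) (f \o chart_inv i).

(** Continuity of [f] makes the sets [U `&` f @^-1` chart_dom j] open. *)
Definition smooth_map_on (R : realType) (V W : normedModType R)
    (S T : topologicalType) (A : charts V S) (B : charts W T)
    (U : set S) (f : S -> T) : Prop :=
  (forall x, U x -> {for x, continuous f}) /\
  forall j : chart_idx B,
    smooth_fun_on A (U `&` f @^-1` chart_dom j) (chart_map j \o f).

Definition smooth (R : realType) (m n : nat) (M : manifold R m)
    (N : manifold R n) (f : M -> N) : Prop :=
  smooth_map_on (atlas M) (atlas N) setT f.

Definition submersion (R : realType) (m n : nat) (M : manifold R m)
    (N : manifold R n) (f : M -> N) : Prop :=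
  smooth f /\
  forall (x : M) (i : chart_idx (atlas M)) (j : chart_idx (atlas N)),
    chart_dom i x -> chart_dom j (f x) ->
    forall w, exists v,
      'd (chart_map j \o f \o chart_inv i) (chart_map i x) v = w.

Definition Cinfty (R : realType) (n : nat) (M : manifold R n)
    (f : M -> R^o) : Prop :=
  smooth_fun_on (atlas M) setT f.

Section SmoothTheory.
Context (R : realType) (V W : normedModType R) (S : topologicalType).
Context (A : charts V S) (AP : smooth_atlas A) (U : set S) (oU : open U).

Lemma chart_imageI_open (i : chart_idx A) :
  open (chart_map i @` (chart_dom i `&` U)).
Proof.
have -> : chart_map i @` (chart_dom i `&` U) =
    chart_image i `&` chart_inv i @^-1` U.
  apply/seteqP; split=> [_ [x [ix Ux] <-]|_ [[x ix <-]]] /=.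
    by split; [exists x | rewrite chart_mapK].
  by rewrite chart_mapK // => Ux; exists x.
rewrite openE => y [iy Uy]; apply: filterI.
  by apply: open_nbhs_nbhs; split=> //; exact: chart_image_open.
by apply: (chart_inv_cont AP iy); apply: open_nbhs_nbhs.
Qed.

Lemma smooth_fun_on_cst (w : W) : smooth_fun_on A U (fun=> w).
Proof. by move=> i k; apply: Ck_cst; exact: chart_imageI_open. Qed.

Lemma smooth_fun_on_lin (a : R) (f g : S -> W) :
  smooth_fun_on A U f -> smooth_fun_on A U g ->
  smooth_fun_on A U (fun x => a *: f x + g x).
Proof.
by move=> sf sg i k; apply: Ck_lin; [exact: chart_imageI_open|exact: sf|exact: sg].
Qed.

Lemma eq_smooth_fun_on (f g : S -> W) : (forall x, U x -> f x = g x) ->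
  smooth_fun_on A U f -> smooth_fun_on A U g.
Proof.
move=> fg sf i k; apply: eq_Ck (sf i k); first exact: chart_imageI_open.
by move=> _ [x [ix Ux] <-] /=; rewrite chart_mapK //; exact: fg.
Qed.

End SmoothTheory.

(** [mul g r] stands for the product [gr]; it is a total function, but only
    its values on composable pairs ([src g = tgt r]) are constrained.
    Smoothness of the multiplication on the embedded submanifold of composable
    pairs is stated as the existence of local smooth extensions to open subsets
    of the product manifold. *)
Record lie_groupoid (R : realType) := LieGroupoid {
  obj_dim : nat;
  arr_dim : nat;
  obj : manifold R obj_dim;
  arr : manifold R arr_dim;
  src : arr -> obj;
  tgt : arr -> obj;
  one : obj -> arr;
  inv : arr -> arr;
  mul : arr -> arr -> arr;
  src_one : forall x, src (one x) = x;
  tgt_one : forall x, tgt (one x) = x;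
  src_inv : forall g, src (inv g) = tgt g;
  tgt_inv : forall g, tgt (inv g) = src g;
  src_mul : forall g r, src g = tgt r -> src (mul g r) = src r;
  tgt_mul : forall g r, src g = tgt r -> tgt (mul g r) = tgt g;
  mulA : forall g h k, src g = tgt h -> src h = tgt k ->
    mul g (mul h k) = mul (mul g h) k;
  mul_onel : forall g, mul (one (tgt g)) g = g;
  mul_oner : forall g, mul g (one (src g)) = g;
  mul_invl : forall g, mul (inv g) g = one (src g);
  mul_invr : forall g, mul g (inv g) = one (tgt g);
  src_submersion : submersion src;
  tgt_submersion : submersion tgt;
  one_smooth : smooth one;
  inv_smooth : smooth inv;
  mul_smooth : forall p : arr * arr, src p.1 = tgt p.2 ->
    exists (U : set (arr * arr)) (m : arr * arr -> arr),
      [/\ open U, U p,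
          smooth_map_on (prod_charts (atlas arr) (atlas arr)) (atlas arr) U m &
          forall q, U q -> src q.1 = tgt q.2 -> m q = mul q.1 q.2] }.

(** A bundle is presented by its fibres and a trivializing cover; the smooth
    structure of the total space is the one determined by the smooth transition
    functions. *)
Record vector_bundle (R : realType) (n : nat) (M : manifold R n) :=
  VectorBundle {
    rank : nat;
    fiber :> M -> lmodType R;
    triv_idx : Type;
    triv_dom : triv_idx -> set M;
    triv : triv_idx -> forall x, {linear fiber x -> 'rV[R]_rank};
    triv_inv : triv_idx -> forall x, 'rV[R]_rank -> fiber x;
    triv_cover : forall x, exists i, triv_dom i x;
    triv_dom_open : forall i, open (triv_dom i);
    trivK : forall i x, triv_dom i x -> cancel (triv i x) (triv_inv i x);
    triv_invK : forall i x, triv_dom i x -> cancel (triv_inv i x) (triv i x);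
    triv_transition : forall i j (v : 'rV[R]_rank),
      smooth_fun_on (atlas M) (triv_dom i `&` triv_dom j)
        (fun x => triv j x (triv_inv i x v)) }.

(** [c] is a section of the pullback bundle [f^* E]. *)
Definition smooth_section_along (R : realType) (m n : nat) (N : manifold R m)
    (M : manifold R n) (E : vector_bundle M) (f : N -> M)
    (c : forall y : N, E (f y)) : Prop :=
  forall i : triv_idx E,
    smooth_fun_on (atlas N) (f @^-1` triv_dom i) (fun y => triv i (f y) (c y)).

Definition smooth_section (R : realType) (n : nat) (M : manifold R n)
    (E : vector_bundle M) (nu : forall x : M, E x) : Prop :=
  @smooth_section_along R n n M M E id nu.

(** [fcast] transports vectors along the identities between base points, such as
    [t (gr) = t g], that hold only propositionally.  The action is smooth when
    its matrices in local trivializations are; it is invertible because of the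
    two action laws. *)
Record gmodule (R : realType) (G : lie_groupoid R) := GModule {
  gbundle :> vector_bundle (obj G);
  act : forall g : arr G, {linear gbundle (src g) -> gbundle (tgt g)};
  act_one : forall (x : obj G) (e : gbundle x),
    act (one x) (fcast (esym (src_one x)) e) = fcast (esym (tgt_one x)) e;
  act_mul : forall (g r : arr G) (gr : src g = tgt r) (e : gbundle (src r)),
    act (mul g r) (fcast (esym (src_mul gr)) e) =
    fcast (esym (tgt_mul gr)) (act g (fcast (esym gr) (act r e)));
  act_smooth : forall (i j : triv_idx gbundle) (v : 'rV[R]_(rank gbundle)),
    smooth_fun_on (atlas (arr G))
      (@src R G @^-1` triv_dom i `&` @tgt R G @^-1` triv_dom j)
      (fun g => triv j (tgt g) (act g (triv_inv i (src g) v))) }.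

Section Cohomology.
Context (R : realType) (G : lie_groupoid R) (E : gmodule G).

Definition tgt_sections := dfun (fun g : arr G => E (tgt g)).

Definition is_cocycle (c : tgt_sections) : Prop :=
  smooth_section_along (E := E) (f := @tgt R G) c /\
  forall (g r : arr G) (gr : src g = tgt r),
    c (mul g r) =
    fcast (esym (tgt_mul gr)) (c g + act E g (fcast (esym gr) (c r))).

Definition coboundary (nu : forall x : obj G, E x) : tgt_sections :=
  fun g => act E g (nu (src g)) - nu (tgt g).

Lemma fcast_lin (T : Type) (F : T -> lmodType R) (x y : T) (xy : x = y) a u v :
  fcast xy (a *: u + v : F x) = a *: fcast xy u + fcast xy v.
Proof. by case: y / xy. Qed.

Lemma fcast0 (T : Type) (F : T -> lmodType R) (x y : T) (xy : x = y) :
  fcast xy (0 : F x) = 0.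
Proof. by case: y / xy. Qed.

Lemma tgt_preimage_open (U : set (obj G)) : open U -> open (@tgt R G @^-1` U).
Proof.
move=> oU; apply: open_comp => // g _.
by case: (tgt_submersion G) => -[tc _] _; exact: tc.
Qed.

Lemma smooth_section_along_lin m (N : manifold R m) (f : N -> obj G) a
    (b c : dfun (fun y : N => E (f y))) :
  (forall U, open U -> open (f @^-1` U)) ->
  smooth_section_along b -> smooth_section_along c ->
  @smooth_section_along _ _ _ N _ E f (a *: b + c).
Proof.
move=> fo sb sc i; have oi := fo _ (@triv_dom_open _ _ _ E i).
apply: eq_smooth_fun_on (smooth_fun_on_lin _ _ a (sb i) (sc i)) => //.
- exact: atlasP.
- by move=> y _; rewrite linearP.
- exact: atlasP.
Qed.

Lemma smooth_section_along0 m (N : manifold R m) (f : N -> obj G) :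
  (forall U, open U -> open (f @^-1` U)) ->
  @smooth_section_along _ _ _ N _ E f (fun=> 0).
Proof.
move=> fo i; have oi := fo _ (@triv_dom_open _ _ _ E i).
apply: eq_smooth_fun_on (smooth_fun_on_cst _ _ 0) => //.
- exact: atlasP.
- by move=> y _; rewrite linear0.
- exact: atlasP.
Qed.

Lemma is_cocycle0 : is_cocycle 0.
Proof.
split; first exact: smooth_section_along0 tgt_preimage_open.
by move=> g r gr; rewrite fcast0 linear0 addr0 fcast0.
Qed.

Lemma is_cocycleP a b c : is_cocycle b -> is_cocycle c -> is_cocycle (a *: b + c).
Proof.
move=> [sb cb] [sc cc]; split.
  exact: smooth_section_along_lin tgt_preimage_open sb sc.
move=> g r gr; rewrite -[LHS]/(a *: b (mul g r) + c (mul g r)) (cb _ _ gr) (cc _ _ gr).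
rewrite -fcast_lin; congr fcast.
rewrite -[(a *: b + c) g]/(a *: b g + c g) -[(a *: b + c) r]/(a *: b r + c r).
by rewrite fcast_lin linearP scalerDr addrACA.
Qed.

Definition cocycles : submodule tgt_sections := Submodule is_cocycle0 is_cocycleP.

(** The space of coboundaries is formed inside the space of cocycles; every
    [coboundary nu] with [nu] smooth is a cocycle, so nothing is lost. *)
Definition is_coboundary (c : subspace cocycles) : Prop :=
  exists2 nu : forall x : obj G, E x,
    smooth_section nu & subspace_val c = coboundary nu.

Lemma is_coboundary0 : is_coboundary 0.
Proof.
exists (fun=> 0); first exact: smooth_section_along0.
apply: functional_extensionality_dep => g.
by rewrite /coboundary linear0 subr0.
Qed.

Lemma is_coboundaryP a b c :
  is_coboundary b -> is_coboundary c -> is_coboundary (a *: b + c).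
Proof.
move=> [mu smu bE] [nu snu cE].
exists (a *: (mu : dfun E) + (nu : dfun E)); first exact: smooth_section_along_lin.
rewrite [LHS](linearP (val : subspace cocycles -> _)) /= bE cE.
apply: functional_extensionality_dep => g.
by rewrite /coboundary !dfun_linE linearP scalerBr opprD addrACA.
Qed.

Definition coboundaries : submodule (subspace cocycles) :=
  Submodule is_coboundary0 is_coboundaryP.

Definition H1 : lmodType R := lmod_quot coboundaries.

End Cohomology.

Section Trivial.
Context (R : realType) (G : lie_groupoid R).

Lemma const_row_linear : linear (fun r : R^o => const_mx r : 'rV[R]_1).
Proof. by move=> a u v; apply/rowP => i; rewrite !mxE. Qed.

Definition const_row : {linear R^o -> 'rV[R]_1} :=
  HB.pack (fun r : R^o => const_mx r : 'rV[R]_1)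
    (GRing.isLinear.Build R R^o 'rV[R]_1 *:%R _ const_row_linear).

Definition row_val (v : 'rV[R]_1) : R^o := v 0 0.

Lemma const_rowK : cancel const_row row_val.
Proof. by move=> r; rewrite /row_val mxE. Qed.

Lemma row_valK : cancel row_val const_row.
Proof. by move=> v; apply/rowP => i; rewrite mxE (ord1 i). Qed.

Definition trivial_line_bundle (n : nat) (M : manifold R n) : vector_bundle M.
Proof.
refine (@VectorBundle R n M 1 (fun=> R^o) unit (fun=> setT)
  (fun _ _ => const_row) (fun _ _ => row_val) _ _ _ _ _).
- by move=> x; exists tt.
- by move=> _; exact: openT.
- by move=> _ x _; exact: const_rowK.
- by move=> _ x _; exact: row_valK.
- move=> _ _ v; apply: smooth_fun_on_cst; first exact: atlasP.
  by rewrite setTI; exact: openT.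
Defined.

Lemma fcast_cst (T : Type) (x y : T) (xy : x = y) (e : R^o) :
  fcast (E := fun=> R^o) xy e = e.
Proof. by case: y / xy. Qed.

Definition trivial_gmodule : gmodule G.
Proof.
refine (@GModule R G (trivial_line_bundle (obj G)) (fun g => idfun) _ _ _).
- by move=> x e; rewrite /= !fcast_cst.
- by move=> g r gr e; rewrite /= !fcast_cst.
- move=> i j v; rewrite /= !preimage_setT setTI.
  exact: (smooth_fun_on_cst (atlasP _) openT (const_row (row_val v))).
Defined.

End Trivial.

Section Multiplicative.
Context (R : realType) (G : lie_groupoid R).

Definition is_multiplicative (F : arr G -> R^o) : Prop :=
  Cinfty F /\
  forall g r : arr G, src g = tgt r -> F (mul g r) = F g + F r.

Lemma is_multiplicative0 : is_multiplicative 0.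
Proof.
split; last by move=> g r _; rewrite addr0.
by apply: smooth_fun_on_cst; [exact: atlasP | exact: openT].
Qed.

Lemma is_multiplicativeP a F F' : is_multiplicative F -> is_multiplicative F' ->
  is_multiplicative (a *: F + F').
Proof.
move=> [sF mF] [sF' mF']; split.
  by apply: smooth_fun_on_lin => //; [exact: atlasP | exact: openT].
move=> g r gr; rewrite -[LHS]/(a *: F (mul g r) + F' (mul g r)) mF // mF' //.
by rewrite scalerDr addrACA.
Qed.

Definition multiplicative_vectors : submodule (arr G -> R^o) :=
  Submodule is_multiplicative0 is_multiplicativeP.

(** As for coboundaries, [t^*f - s^*f] is always multiplicative. *)
Definition is_exact (F : subspace multiplicative_vectors) : Prop :=
  exists2 f : obj G -> R^o,
    Cinfty f & forall g : arr G, subspace_val F g = f (tgt g) - f (src g).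

Lemma is_exact0 : is_exact 0.
Proof.
exists (fun=> 0); last by move=> g; rewrite subr0.
by apply: smooth_fun_on_cst; [exact: atlasP | exact: openT].
Qed.

Lemma is_exactP a F F' : is_exact F -> is_exact F' -> is_exact (a *: F + F').
Proof.
move=> [f sf fE] [f' sf' fE']; exists (fun x => a *: f x + f' x).
  by apply: smooth_fun_on_lin => //; [exact: atlasP | exact: openT].
move=> g.
rewrite -[LHS]/(a *: subspace_val F g + subspace_val F' g) fE fE'.
by rewrite scalerBr opprD addrACA.
Qed.

Definition exact_vectors : submodule (subspace multiplicative_vectors) :=
  Submodule is_exact0 is_exactP.

Definition R0mult : lmodType R := lmod_quot exact_vectors.

End Multiplicative.

(* Main.v *)
Require Import Defs.
From HB Require Import structures.
From mathcomp Require Import all_boot all_order all_algebra.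
From mathcomp Require Import all_classical all_reals all_analysis.
Import Order.TTheory GRing.Theory Num.Theory.
Import numFieldNormedType.Exports.
Local Open Scope ring_scope.

Set Implicit Arguments.
Unset Strict Implicit.
Unset Printing Implicit Defensive.

(** On the trivial line bundle every fibre is the line [R] and every [Phi_g] is
    the identity, so a section of [t^*E] is a function on the arrows and the
    cocycle equation [c(gr) = c(g) + Phi_g c(r)] is multiplicativity.  The
    differential of [nu] is [s^*nu - t^*nu], which is the exact [0]-vector of
    [- nu]; hence the exact [0]-vectors and the coboundaries are the same
    functions, and the identity on functions descends to an isomorphism of the
    two quotients ([subspace_iso], then [lmod_quot_iso]).

    The analytic point is that the two notions of smoothness agree.  A section
    is smooth when its coordinate rows in the trivialization are, whereas a
    [0]-vector is smooth as a scalar function.  The two are exchanged by the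
    mutually inverse continuous linear maps [const_row] and [row_val], and
    composition with a continuous linear map preserves smoothness because it
    commutes with directional derivatives ([Ck_comp_linear]). *)

Section Isomorphisms.
Context (R : pzRingType) (V W : lmodType R).
Context (S : submodule V) (S' : submodule W) (f : {linear V -> W}).
Hypothesis f_bij : bijective f.
Hypothesis f_sub : forall v, submod_set S v <-> submod_set S' (f v).

Lemma submod_predE v : (f v \in submod_pred S') = (v \in submod_pred S).
Proof. by apply/asboolP/asboolP => /f_sub. Qed.

Lemma subspace_valP (u : Defs.subspace S) : subspace_val u \in submod_pred S.
Proof. exact: (valP u). Qed.

(** The equation on underlying vectors is what allows a further submodule of
    [subspace S] to be compared with one of [subspace S']. *)
Lemma subspace_iso : exists2 phi : {linear Defs.subspace S -> Defs.subspace S'},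
  bijective phi & forall u, subspace_val (phi u) = f (subspace_val u).
Proof.
have [g fK gK] := f_bij.
have fS (u : Defs.subspace S) : f (subspace_val u) \in submod_pred S'.
  by rewrite submod_predE subspace_valP.
have gS (w : Defs.subspace S') : g (subspace_val w) \in submod_pred S.
  by rewrite -submod_predE gK; exact: (valP w).
pose h (u : Defs.subspace S) : Defs.subspace S' := Subspace (fS u).
have h_lin : linear h.
  move=> a u v; apply: val_inj.
  rewrite [RHS](linearP (val : Defs.subspace S' -> _)) /= -linearP.
  by congr (f _); exact: (linearP (val : Defs.subspace S -> _)).
pose phi : {linear Defs.subspace S -> Defs.subspace S'} :=
  HB.pack h (GRing.isLinear.Build R _ _ *:%R _ h_lin).
exists phi => //; exists (fun w => Subspace (gS w)) => x; apply: val_inj => /=.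
  by rewrite fK.
by rewrite gK.
Qed.

Local Open Scope quotient_scope.

Lemma lmod_quot_iso :
  exists phi : {linear lmod_quot S -> lmod_quot S'}, bijective phi.
Proof.
have [g fK gK] := f_bij.
pose h (x : lmod_quot S) : lmod_quot S' := \pi_(lmod_quot S') (f (repr x)).
pose k (y : lmod_quot S') : lmod_quot S := \pi_(lmod_quot S) (g (repr y)).
have hE v : h (\pi_(lmod_quot S) v) = \pi_(lmod_quot S') (f v).
  apply/eqP; rewrite -Quotient.idealrBE -linearB submod_predE.
  by rewrite Quotient.idealrBE reprK.
have kE w : k (\pi_(lmod_quot S') w) = \pi_(lmod_quot S) (g w).
  apply/eqP; rewrite -Quotient.idealrBE -submod_predE linearB !gK.
  by rewrite Quotient.idealrBE reprK.
have h_lin : linear h.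
  move=> a; elim/quotW=> u; elim/quotW=> v.
  rewrite -[a *: \pi_(lmod_quot S) u]/(lmod_quot_scale a _) pi_scale -raddfD.
  rewrite !hE linearP.
  by rewrite -[X in _ = X + _]/(lmod_quot_scale a _) pi_scale -raddfD.
pose phi : {linear lmod_quot S -> lmod_quot S'} :=
  HB.pack h (GRing.isLinear.Build R _ _ *:%R _ h_lin).
exists phi; exists k.
  by elim/quotW=> u; rewrite /= hE kE fK.
by elim/quotW=> w; rewrite /= kE hE gK.
Qed.

End Isomorphisms.

Section ContinuousLinear.
Context (R : realType) (V W W' : normedModType R) (L : {linear W -> W'}).
Hypothesis L_cont : continuous L.

Local Open Scope classical_set_scope.

(** By linearity the difference quotient of [L \o f] is [L] of that of [f]. *)
Lemma cvg_derive_comp_linear (f : V -> W) x v : derivable f x v ->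
  h^-1 *: (((L \o f) \o shift x) (h *: v) - (L \o f) x) @[h --> 0^'] -->
  L ('D_v f x).
Proof.
move=> df.
have -> : (fun h : R => h^-1 *: (((L \o f) \o shift x) (h *: v) - (L \o f) x)) =
    L \o (fun h : R => h^-1 *: ((f \o shift x) (h *: v) - f x)).
  by apply/funext => h /=; rewrite -linearB linearZ_LR.
by apply: continuous_cvg; [exact: L_cont|exact: df].
Qed.

Lemma Ck_comp_linear k (U : set V) (f : V -> W) : open U ->
  Ck k U f -> Ck k U (L \o f).
Proof.
move=> oU; elim: k f => [|k IHk] f /= Cf.
  by move=> x Ux; apply: continuous_comp; [exact: Cf|exact: L_cont].
move=> v; have [df Cdf] := Cf v; split=> [x Ux|].
  by apply/cvg_ex; exists (L ('D_v f x)); exact: cvg_derive_comp_linear (df _ Ux).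
apply: eq_Ck (IHk _ Cdf) => // x Ux /=.
by apply/esym/cvg_lim => //; exact: cvg_derive_comp_linear (df _ Ux).
Qed.

Lemma smooth_fun_on_comp_linear (T : topologicalType) (A : charts V T)
    (U : set T) (f : T -> W) : smooth_atlas A -> open U ->
  smooth_fun_on A U f -> smooth_fun_on A U (L \o f).
Proof.
move=> AP oU sf i k.
by apply: (Ck_comp_linear _ (sf i k)); exact: chart_imageI_open.
Qed.

End ContinuousLinear.

Section TrivialLine.
Context (R : realType).

Lemma const_row_continuous : continuous (const_row R).
Proof.
move=> r.
have -> : (const_row R : R^o -> 'rV[R]_1) = (fun a => a *: const_mx 1).
  by apply/funext => a; apply/rowP => i; rewrite !mxE mulr1.
exact: scalel_continuous.
Qed.

Lemma row_val_linear : linear (@row_val R).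
Proof. by move=> a u v; rewrite /row_val !mxE. Qed.

Lemma row_val_continuous : continuous (@row_val R).
Proof. exact: coord_continuous. Qed.

Lemma smooth_const_rowE (V : normedModType R) (T : topologicalType)
    (A : charts V T) (U : set T) (f : T -> R^o) : smooth_atlas A -> open U ->
  smooth_fun_on A U (const_row R \o f) <-> smooth_fun_on A U f.
Proof.
move=> AP oU; split=> sf; last first.
  exact: (smooth_fun_on_comp_linear const_row_continuous AP oU sf).
pose L : {linear 'rV[R]_1 -> R^o} :=
  HB.pack (@row_val R) (GRing.isLinear.Build R _ R^o *:%R _ row_val_linear).
have := @smooth_fun_on_comp_linear _ _ _ _ L row_val_continuous _ _ _ _ AP oU sf.
by apply: eq_smooth_fun_on => // x _; exact: const_rowK.
Qed.

(** The map [f] is arbitrary because the only trivializing domain is the whole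
    base, whose preimage is the whole manifold: [f := tgt] serves for cocycles
    and [f := id] for sections over the objects. *)
Lemma smooth_section_trivialE m n (N : manifold R m) (M : manifold R n)
    (f : N -> M) (c : N -> R^o) :
  smooth_section_along (E := trivial_line_bundle M) (f := f) c <-> Cinfty c.
Proof.
have E := smooth_const_rowE c (atlasP N) openT.
by split=> [/(_ tt)|sc []]; [rewrite preimage_setT => /E | apply/E].
Qed.

End TrivialLine.

Section TrivialCocycles.
Context (R : realType) (G : lie_groupoid R).

Definition section_of_fun (F : arr G -> R^o) :
  tgt_sections (trivial_gmodule G) := F.

Lemma section_of_fun_linear : linear section_of_fun.
Proof. by []. Qed.

Lemma section_of_fun_bij : bijective section_of_fun.
Proof. by exists id. Qed.

Lemma multiplicativeE (F : arr G -> R^o) :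
  is_multiplicative F <-> is_cocycle (section_of_fun F).
Proof.
have E := smooth_section_trivialE (@tgt R G) F.
(* The fibre does not depend on the base point, so transporting is the identity. *)
have castE g r (gr : src g = tgt r) :
    fcast (esym (tgt_mul gr))
      (section_of_fun F g +
       act (trivial_gmodule G) g (fcast (esym gr) (section_of_fun F r))) =
    F g + F r :> R^o.
  by apply: etrans (fcast_cst _ _) _; congr (_ + _); exact: fcast_cst.
split=> -[sF mF]; split; try exact/E.
  by move=> g r gr; rewrite castE; exact: mF.
by move=> g r gr; rewrite -(castE _ _ gr); exact: mF.
Qed.

Lemma CinftyN n (M : manifold R n) (f : M -> R^o) :
  Cinfty f -> Cinfty (fun x => - f x).
Proof.
move=> sf.
have s0 := smooth_fun_on_cst (atlasP M) openT (0 : R^o).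
have := smooth_fun_on_lin (atlasP M) openT (-1) sf s0.
apply: eq_smooth_fun_on; [exact: atlasP|exact: openT|].
by move=> x _; rewrite addr0 scaleN1r.
Qed.

(** The potential changes sign: [t^*f - s^*f] is the differential of [- f]. *)
Lemma exactE (F : arr G -> R^o) :
  (exists2 f : obj G -> R^o,
    Cinfty f & forall g, F g = f (tgt g) - f (src g)) <->
  (exists2 nu : forall x : obj G, trivial_gmodule G x,
    smooth_section nu & section_of_fun F = coboundary nu).
Proof.
split=> -[f sf FE]; exists (fun x => - (f x : R^o)).
- exact/smooth_section_trivialE/CinftyN.
- apply: functional_extensionality_dep => g.
  by rewrite /section_of_fun FE /coboundary /= opprK addrC.
- by apply: CinftyN; exact/(smooth_section_trivialE id).
- move=> g; rewrite -[F g]/(section_of_fun F g) FE /coboundary /=.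
  by rewrite opprK addrC.
Qed.

End TrivialCocycles.

Unset Implicit Arguments.

Theorem proposition6p2 (R : realType) (G : lie_groupoid R) :
  exists phi : {linear R0mult G -> H1 (trivial_gmodule G)}, bijective phi.
Proof.
pose iota : {linear (arr G -> R^o) -> tgt_sections (trivial_gmodule G)} :=
  HB.pack (@section_of_fun R G)
    (GRing.isLinear.Build R _ _ *:%R _ (@section_of_fun_linear R G)).
have [psi psi_bij psiE] := @subspace_iso _ _ _ (multiplicative_vectors G)
  (cocycles (trivial_gmodule G)) iota (@section_of_fun_bij R G)
  (@multiplicativeE R G).
apply: (@lmod_quot_iso _ _ _ _ _ psi psi_bij) => F /=.
by rewrite /is_coboundary psiE; exact: exactE.
Qed.
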